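(* Let $w\in\mathcal{W}^0=\ker(\varepsilon)$. Then $$\ell_{\Pi_0}(w)=|\mathrm{ht}(T(w))|.$$ In particular, if $T(w)=\sum_{i=0}^\nu n_i\alpha_i$ (with $n_i\in\mathbb{Z}$ and $\Pi_0=\{\alpha_0,\dots,\alpha_\nu\}$), then $\ell_{\Pi_0}(w)=\sum_{i=0}^\nu|n_i|$.
   Context: Let $A$ be a free abelian group of rank $\nu+1$ with a symmetric positive semidefinite bi-additive form $(\cdot,\cdot):A\times A\to\mathbb{Q}$ whose radical is $\Lambda=\{\alpha:(\alpha,A)=0\}$; let $\{\epsilon,\sigma_1,\dots,\sigma_\nu\}$ be a $\mathbb{Z}$-basis of $A$ with $\{\sigma_1,\dots,\sigma_\nu\}$ a $\mathbb{Z}$-basis of $\Lambda$ and $(\epsilon,\epsilon)=2$. Let $\tilde R=\{k\epsilon+\sigma:k\in\{0,\pm1\},\sigma\in\Lambda\}$ and $\tilde R^\times=\pm\epsilon+\Lambda$. For $\alpha\in\tilde R^\times$, $w_\alpha\in\mathrm{Aut}(A)$ is $w_\alpha(\beta)=\beta-\frac{2(\beta,\alpha)}{(\alpha,\alpha)}\alpha$, and $\mathcal{W}=\langle w_\alpha:\alpha\in\tilde R^\times\rangle$. Each $\alpha\in A$ is written $\alpha=\mathrm{sgn}(\alpha)\epsilon+p(\alpha)$ with $\mathrm{sgn}(\alpha)\in\mathbb{Z}$, $p(\alpha)\in\Lambda$. For $w=w_{\gamma_1}\cdots w_{\gamma_n}\in\mathcal{W}$ with $\gamma_i\in\tilde R^\times$,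 put $\varepsilon(w)=(-1)^n$ and $T(w)=\sum_{i=1}^n(-1)^{n-i}\mathrm{sgn}(\gamma_i)p(\gamma_i)\in\Lambda$; both are independent of the expression, and $\varepsilon:\mathcal{W}\to\{\pm1\}$ is a homomorphism. For $\sigma=\sum_{i=1}^\nu m_i\sigma_i\in\Lambda$ put $m^+=\sum_{m_i>0}m_i$, $m^-=\sum_{m_i<0}m_i$, and $\mathrm{ht}_{\mathfrak{B}^0}(\sigma)=2m^+$ if $m^+\ge|m^-|$, $=2m^-$ if $m^+<|m^-|$. For $\alpha=k\epsilon+\sigma\in\tilde R$, $\mathrm{ht}(\alpha)=k-\mathrm{ht}_{\mathfrak{B}^0}(\sigma)$ if $k=-1$ and $m^+=|m^-|$, and $\mathrm{ht}(\alpha)=k+\mathrm{ht}_{\mathfrak{B}^0}(\sigma)$ otherwise; in particular $\mathrm{ht}(\sigma)=\mathrm{ht}_{\mathfrak{B}^0}(\sigma)$ for $\sigma\in\Lambda$. The fundamental root basis is $\Pi_0=\{\alpha_0=\epsilon,\ \alpha_1=\sigma_1-\epsilon,\dots,\alpha_\nu=\sigma_\nu-\epsilon\}$, a $\mathbb{Z}$-basis of $A$; the reflections $w_{\alpha_0},\dots,w_{\alpha_\nu}$ generate $\mathcal{W}$. For $w\in\mathcal{W}$, $\ell_{\Pi_0}(w)$ is the smallest $k\ge0$ such that $w=w_{\beta_1}\cdots w_{\beta_k}$ with all $\beta_j\in\Pi_0$ ($\ell_{\Pi_0}(1)=0$). *)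

(* Defs.v *)
From HB Require Import structures.
From mathcomp Require Import all_boot all_order all_algebra.
From mathcomp Require Import boolp classical_sets.
From mathcomp Require Import ring.
Set Implicit Arguments. Unset Strict Implicit. Unset Printing Implicit Defensive.
Import Order.TTheory GRing.Theory Num.Theory.
Local Open Scope ring_scope.
Local Open Scope classical_set_scope.

Definition zcomb (A : zmodType) (I : finType) (b : I -> A)
    (c : {ffun I -> int}) : A :=
  \sum_i b i *~ c i.

Definition is_zbasis (A : zmodType) (I : finType) (b : I -> A) (S : set A) :=
  injective (zcomb b) /\ range (zcomb b) = S.

Definition radical (A : zmodType) (form : A -> A -> rat) : set A :=
  [set a | forall b, form a b = 0].

(* Index 0 of a family over 'I_nu.+1 carries x, index i + 1 carries y i. *)
Definition ord_cons (T : Type) (nu : nat) (x : T) (y : 'I_nu -> T)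
    (i : 'I_nu.+1) : T :=
  if unlift ord0 i is Some j then y j else x.

Record A1_datum (nu : nat) := A1Datum {
  lattice :> zmodType;
  form : lattice -> lattice -> rat;
  eps : lattice;
  sigma : 'I_nu -> lattice;
  formDl : forall a b c, form (a + b) c = form a c + form b c;
  formDr : forall a b c, form a (b + c) = form a b + form a c;
  formC : forall a b, form a b = form b a;
  form_ge0 : forall a, 0 <= form a a;
  basisA : is_zbasis (ord_cons eps sigma) [set: lattice];
  basis_radical : is_zbasis sigma (radical form);
  form_eps : form eps eps = 2
}.

Arguments form {nu _}.
Arguments eps {nu _}.
Arguments sigma {nu _}.

Section Definitions.
Variables (nu : nat) (A : A1_datum nu).
Implicit Types (a b g : A) (w : A -> A) (gs : seq A).

Definition Lambda : set A := radical (@form nu A).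

Definition coord a : {ffun 'I_nu.+1 -> int} :=
  xget 0 [set c | zcomb (ord_cons eps sigma) c = a].

Definition sgn a : int := coord a ord0.
Definition scoord a (i : 'I_nu) : int := coord a (lift ord0 i).
Definition p a : A := \sum_i sigma i *~ scoord a i.

Definition Rtimes : set A :=
  [set a | exists2 s, Lambda s & a = eps + s \/ a = - eps + s].

(* The rational 2(b, a)/(a, a) is an integer for a in Rtimes (lemma refl_coef
   below), so that taking its numerator merely casts it from rat to int. *)
Definition refl a b : A := b - a *~ numq (2 * form b a / form a a).

(* Automorphisms of A are represented by their underlying functions. *)
Inductive weyl : (A -> A) -> Prop :=
| weyl_id : weyl id
| weyl_refl a : Rtimes a -> weyl (refl a)
| weyl_comp u v : weyl u -> weyl v -> weyl (u \o v)
| weyl_inv u v : weyl u -> cancel u v -> cancel v u -> weyl v.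

Definition word gs : A -> A := foldr (fun g f => refl g \o f) id gs.

Definition expressions (X : set A) w : set (seq A) :=
  [set gs : seq A | (forall g, g \in gs -> X g) /\ w = word gs].

(* The exponent n - i of the 1-based formula becomes n - i.+1. *)
Definition word_T gs : A :=
  \sum_(i < size gs) p gs`_i *~ ((-1) ^+ (size gs - i.+1) * sgn gs`_i).

(* epsW and T are computed on a chosen expression; lemmas epsW_word and T_word
   below show that every expression gives the same value. *)
Definition epsW w : int := (-1) ^+ size (xget [::] (expressions Rtimes w)).
Definition T w : A := word_T (xget [::] (expressions Rtimes w)).

Definition weyl0 w : Prop := weyl w /\ epsW w = 1.

Definition mplus a : int := \sum_(i < nu | 0 < scoord a i) scoord a i.
Definition mminus a : int := \sum_(i < nu | scoord a i < 0) scoord a i.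

Definition ht0 a : int :=
  if `|mminus a| <= mplus a then 2 * mplus a else 2 * mminus a.

(* Meaningful for a = k eps + s with k in {-1, 0, 1}; ht0 a only involves the
   sigma-coordinates of a, hence is the height of p a. *)
Definition ht a : int :=
  if (sgn a == -1) && (mplus a == `|mminus a|) then sgn a - ht0 a
  else sgn a + ht0 a.

Definition alpha : 'I_nu.+1 -> A := ord_cons eps (fun j => sigma j - eps).
Definition Pi0 : set A := range alpha.

(* The default value 0 is not used on the group weyl, see ellP. *)
Definition ell w : nat :=
  let L := [set k | exists2 bs, expressions Pi0 w bs & size bs = k] in
  xget 0 [set k | L k /\ forall j, L j -> (k <= j)%N].

End Definitions.

Section Consistency.
Variables (nu : nat) (A : A1_datum nu).
Implicit Types (a b g s t : A) (w : A -> A) (gs bs : seq A).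

Lemma ord_cons0 (U : Type) (x : U) (y : 'I_nu -> U) : ord_cons x y ord0 = x.
Proof. by rewrite /ord_cons unlift_none. Qed.

Lemma ord_consS (U : Type) (x : U) (y : 'I_nu -> U) i :
  ord_cons x y (lift ord0 i) = y i.
Proof. by rewrite /ord_cons liftK. Qed.

Lemma coordK a : zcomb (ord_cons eps sigma) (coord a) = a.
Proof.
have [_ ran] := basisA A.
have : [set: A] a by [].
by rewrite -ran => -[c _ ca]; rewrite /coord; apply: (xgetPex 0 (P := [set c' | zcomb _ c' = a])); exists c.
Qed.

Lemma sgn_pE a : a = eps *~ sgn a + p a.
Proof.
rewrite -[LHS]coordK /zcomb big_ord_recl ord_cons0; congr (_ + _).
by apply: eq_bigr => i _; rewrite ord_consS.
Qed.

Lemma coord_zcomb c : coord (zcomb (ord_cons eps sigma) c : A) = c.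
Proof. by have [inj _] := basisA A; apply: inj; rewrite coordK. Qed.

Lemma coordD a b : coord (a + b) = coord a + coord b.
Proof.
rewrite -[RHS]coord_zcomb; congr coord; rewrite -{1}(coordK a) -{1}(coordK b).
by rewrite /zcomb -big_split; apply: eq_bigr => i _; rewrite ffunE mulrzDr.
Qed.

Lemma Lambda_p a : Lambda (p a).
Proof.
have [_ ran] := basis_radical A.
rewrite /Lambda -ran; exists [ffun i => scoord a i] => //.
by apply: eq_bigr => i _; rewrite ffunE.
Qed.

Lemma coord_eps_Lambda (k : int) s : Lambda s ->
  sgn (eps *~ k + s) = k /\ p (eps *~ k + s) = s.
Proof.
have [_ ran] := basis_radical A.
rewrite /Lambda -ran => -[c _ <-].
have E : eps *~ k + zcomb sigma c =
    zcomb (A := A) (ord_cons eps sigma) (finfun (ord_cons k c)).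
  rewrite /zcomb big_ord_recl ffunE !ord_cons0; congr (_ + _).
  by apply: eq_bigr => i _; rewrite ffunE !ord_consS.
rewrite E /sgn /p /scoord coord_zcomb ffunE ord_cons0; split=> //.
by apply: eq_bigr => i _; rewrite ffunE ord_consS.
Qed.

Lemma LambdaD s t : Lambda s -> Lambda t -> Lambda (s + t).
Proof. by move=> Ls Lt b; rewrite formDl Ls Lt addr0. Qed.

Lemma form0l b : form (0 : A) b = 0.
Proof. by apply: (addrI (form 0 b)); rewrite -formDl !addr0. Qed.

Lemma formNl a b : form (- a) b = - form a b.
Proof. by apply: (addrI (form a b)); rewrite -formDl !subrr form0l. Qed.

Lemma formMzl a b (k : int) : form (a *~ k) b = form a b *~ k.
Proof.
have H n : form (a *+ n) b = form a b *+ n.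
  by elim: n => [|n IH]; rewrite ?mulr0n ?form0l // !mulrS formDl IH.
by case: k => n; [apply: H | rewrite NegzE !mulrNz formNl; congr (- _); apply: H].
Qed.

Lemma formE a b : form a b = (2 * sgn a * sgn b)%:~R.
Proof.
have L1 : forall b, form (p a) b = 0 by apply: Lambda_p.
have L2 : forall a, form (p b) a = 0 by apply: Lambda_p.
rewrite {1}(sgn_pE a) formDl L1 addr0 formMzl formC {1}(sgn_pE b) formDl L2 addr0.
by rewrite formMzl form_eps -!mulrzA -[2 *~ _](mulrzl 2) [RHS]intrM intrM intrM; ring.
Qed.

Lemma LambdaMz s (k : int) : Lambda s -> Lambda (s *~ k).
Proof. by move=> Ls b; rewrite formMzl Ls mul0rz. Qed.

Lemma Rtimes_sgn g : Rtimes g -> sgn g = 1 \/ sgn g = -1.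
Proof.
case=> s Ls [] ->; [left|right].
- by have [] := coord_eps_Lambda 1 Ls.
- by have [] := coord_eps_Lambda (-1) Ls; rewrite mulrNz mulr1z.
Qed.

Lemma sgn_sqr g : Rtimes g -> sgn g * sgn g = 1.
Proof. by case/Rtimes_sgn=> ->. Qed.

Lemma refl_coefE g b : Rtimes g ->
  2 * form b g / form g g = (2 * sgn b * sgn g)%:~R.
Proof.
move=> Rg; rewrite !formE -[2 * sgn g * sgn g]mulrA (sgn_sqr Rg) mulr1.
by rewrite mulrC mulKf.
Qed.

Lemma refl_coef g b : Rtimes g ->
  (numq (2 * form b g / form g g))%:~R = 2 * form b g / form g g.
Proof. by move=> Rg; rewrite refl_coefE // numq_int. Qed.

Lemma reflE g b : Rtimes g ->
  refl g b = eps *~ (- sgn b) + (p b - p g *~ (2 * sgn b * sgn g)).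
Proof.
move=> Rg; rewrite /refl refl_coefE // numq_int.
rewrite {1}(sgn_pE b) {1}(sgn_pE g) mulrzDl -mulrzA.
rewrite mulrCA (sgn_sqr Rg) mulr1 opprD addrACA -mulrzBr; congr (_ *~ _ + _).
by ring.
Qed.

Lemma sgn_refl g b : Rtimes g ->
  sgn (refl g b) = - sgn b /\ p (refl g b) = p b - p g *~ (2 * sgn b * sgn g).
Proof.
move=> Rg; rewrite reflE //; apply: coord_eps_Lambda.
by rewrite -mulrNz; apply: LambdaD; [|apply: LambdaMz]; apply: Lambda_p.
Qed.

Lemma sgn_p_inj a b : sgn a = sgn b -> p a = p b -> a = b.
Proof. by move=> e1 e2; rewrite (sgn_pE a) e1 e2 -sgn_pE. Qed.

Lemma reflK g : Rtimes g -> involutive (refl g).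
Proof.
move=> Rg b; have [s1 p1] := sgn_refl b Rg.
have [s2 p2] := sgn_refl (refl g b) Rg; apply: sgn_p_inj.
  by rewrite s2 s1 opprK.
by rewrite p2 p1 s1 mulrN mulNr mulrNz opprK subrK.
Qed.

Lemma word_T_nil : word_T [::] = 0 :> A.
Proof. exact: big_ord0. Qed.

Lemma word_T_cons g gs :
  word_T (g :: gs) = p g *~ ((-1) ^+ size gs * sgn g) + word_T gs.
Proof. by rewrite /word_T big_ord_recl /= subSS subn0. Qed.

Lemma word_T_cat gs bs :
  word_T (gs ++ bs) = word_T bs + word_T gs *~ (-1) ^+ size bs.
Proof.
elim: gs => [|g gs IH] /=; first by rewrite word_T_nil mul0rz addr0.
rewrite !word_T_cons IH size_cat exprD addrCA; congr (_ + _).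
rewrite mulrzDl -mulrzA; congr (_ *~ _ + _).
by rewrite mulrAC.
Qed.

Lemma word_cat gs bs : word (gs ++ bs) = word gs \o word bs.
Proof. by elim: gs => //= g gs ->. Qed.

Lemma sgn_word gs b : (forall g, g \in gs -> Rtimes g) ->
  sgn (word gs b) = (-1) ^+ size gs * sgn b /\
  p (word gs b) = p b - word_T gs *~ (2 * sgn b).
Proof.
elim: gs => [|g gs IH] H /=.
  by rewrite word_T_nil mul0rz subr0 mul1r.
have Rg : Rtimes g by apply: H; rewrite mem_head.
have [|s1 p1] := IH; first by move=> h hgs; apply: H; rewrite in_cons hgs orbT.
have [s2 p2] := sgn_refl (word gs b) Rg.
rewrite s2 p2 s1 p1 word_T_cons exprS mulN1r mulNr; split=> //.
rewrite mulrzDl opprD -mulrzA [in RHS]addrCA [RHS]addrC; congr (_ - _ *~ _).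
by ring.
Qed.

Lemma word_eqP gs bs :
    (forall g, g \in gs -> Rtimes g) -> (forall g, g \in bs -> Rtimes g) ->
  word gs = word bs <->
  ((-1) ^+ size gs = (-1) ^+ size bs :> int) /\ word_T gs = word_T bs.
Proof.
move=> Hg Hb; split=> [E|[e1 e2]]; last first.
  apply/funext => b; have [s1 p1] := sgn_word b Hg; have [s2 p2] := sgn_word b Hb.
  by apply: sgn_p_inj; rewrite ?s1 ?s2 ?p1 ?p2 ?e1 ?e2.
have [s1 p1] := sgn_word eps Hg; have [s2 p2] := sgn_word eps Hb.
have L0 : @Lambda nu A 0 by move=> b; rewrite form0l.
have [se _] := coord_eps_Lambda 1 L0; rewrite mulr1z addr0 in se.
rewrite E s2 se !mulr1 in s1; split=> //.
rewrite E p2 se mulr1 in p1; move/addrI/oppr_inj: p1 => p1.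
have H x : coord (x *~ 2 : A) = coord x + coord x by rewrite -coordD.
rewrite -[LHS]coordK -[RHS]coordK; congr zcomb; apply/ffunP => i.
have := congr1 (fun x : A => coord x i) p1; rewrite !H !ffunE -!mulr2n.
by move/eqP; rewrite eqr_pMn2r // => /eqP ->.
Qed.

Lemma weyl_word w : weyl w -> expressions (@Rtimes nu A) w !=set0.
Proof.
elim=> {w} [|a Ra|u v _ [gs [Hg ->]] _ [bs [Hb ->]]|u v _ [gs [Hg ->]] uv vu].
- by exists [::].
- by exists [:: a]; split=> // g; rewrite inE => /eqP ->.
- exists (gs ++ bs); split; last by rewrite word_cat.
  by move=> g; rewrite mem_cat => /orP[/Hg|/Hb].
- exists (rev gs); split; first by move=> g; rewrite mem_rev => /Hg.
  have K : cancel (word (rev gs)) (word gs).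
    elim: gs Hg {uv vu} => [|g gs IH] Hg x //=.
    rewrite rev_cons -cats1 word_cat /= IH ?reflK //.
      by apply: Hg; rewrite mem_head.
    by move=> h hgs; apply: Hg; rewrite in_cons hgs orbT.
  by apply/funext => x; rewrite -{1}(K x) uv.
Qed.

Lemma epsW_word gs : (forall g, g \in gs -> Rtimes g) ->
  epsW (word gs) = (-1) ^+ size gs.
Proof.
move=> H; have E : expressions (@Rtimes nu A) (word gs) gs by [].
rewrite /epsW; have [H' E'] := xgetPex [::] (ex_intro _ gs E).
by have [] := (word_eqP H H').1 E'.
Qed.

Lemma T_word gs : (forall g, g \in gs -> Rtimes g) -> T (word gs) = word_T gs.
Proof.
move=> H; have E : expressions (@Rtimes nu A) (word gs) gs by [].
rewrite /T; have [H' E'] := xgetPex [::] (ex_intro _ gs E).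
by have [] := (word_eqP H H').1 E'.
Qed.

Lemma sigma_Lambda i : Lambda (@sigma nu A i).
Proof.
have [_ ran] := basis_radical A; rewrite /Lambda -ran.
exists [ffun j => (j == i)%:Z] => //; rewrite /zcomb (bigD1 i) //=.
rewrite ffunE eqxx mulr1z big1 ?addr0 // => j /negPf ji.
by rewrite ffunE ji mulr0z.
Qed.

Lemma Pi0_Rtimes b : Pi0 b -> @Rtimes nu A b.
Proof.
case=> i _ <-; rewrite /alpha /ord_cons; case: (unlift ord0 i) => [j|].
- by exists (sigma j); [apply: sigma_Lambda | right; rewrite addrC].
- by exists 0; [move=> b'; rewrite form0l | left; rewrite addr0].
Qed.

Lemma Pi0_T s : Lambda s -> exists bs,
  [/\ forall b, b \in bs -> Pi0 b, (-1) ^+ size bs = 1 :> int & word_T bs = s].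
Proof.
pose P s' := exists bs : seq A,
  [/\ forall b, b \in bs -> Pi0 b, (-1) ^+ size bs = 1 :> int & word_T bs = s'].
have P0 : P 0 by exists [::]; split=> //; rewrite word_T_nil.
have PD x y : P x -> P y -> P (x + y).
  case=> [bx [Hx sx tx]] [b_y [Hy sy ty]]; exists (b_y ++ bx); split.
  - by move=> b; rewrite mem_cat => /orP[/Hy|/Hx].
  - by rewrite size_cat exprD sx sy.
  - by rewrite word_T_cat sx mulr1z tx ty.
have L0 : @Lambda nu A 0 by move=> b; rewrite form0l.
have [se pe] := coord_eps_Lambda 1 L0; rewrite mulr1z addr0 in se pe.
have Pe : Pi0 (eps : A) by exists ord0 => //; rewrite /alpha ord_cons0.
have Pj j : Pi0 (sigma j - eps : A).
  by exists (lift ord0 j) => //; rewrite /alpha ord_consS.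
have Psig j : P (sigma j) /\ P (- sigma j).
  have [] := coord_eps_Lambda (-1) (sigma_Lambda j).
  rewrite mulrNz mulr1z addrC => sj pj; split.
  - exists [:: sigma j - eps; eps]; split=> //.
      by move=> b; rewrite !inE => /orP[] /eqP ->.
    by rewrite !word_T_cons word_T_nil se pe sj pj mul0rz !addr0.
  - exists [:: eps; sigma j - eps]; split=> //.
      by move=> b; rewrite !inE => /orP[] /eqP ->.
    by rewrite !word_T_cons word_T_nil se pe sj pj mul0rz add0r addr0 mul1r mulrNz mulr1z.
have PMn x n : P x -> P (x *+ n).
  by move=> Px; elim: n => [|n IH]; rewrite ?mulr0n // mulrS; apply: PD.
have [_ ran] := basis_radical A; rewrite /Lambda -ran => -[c _ <-].
apply: (big_ind P) => // j _; have [P1 P2] := Psig j.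
case: (c j) => n; first exact: PMn.
by rewrite NegzE mulrNz -mulNrz; apply: (PMn _ n.+1).
Qed.

Lemma weyl_Pi0 w : weyl w -> expressions (@Pi0 nu A) w !=set0.
Proof.
case/weyl_word=> gs [Hg ->].
have LT : Lambda (word_T gs).
  by apply: (big_ind (@Lambda nu A)) => [b||i _];
    [rewrite form0l | apply: LambdaD | apply/LambdaMz/Lambda_p].
have L0 : @Lambda nu A 0 by move=> b; rewrite form0l.
have [se pe] := coord_eps_Lambda 1 L0; rewrite mulr1z addr0 in se pe.
have Pe : Pi0 (eps : A) by exists ord0 => //; rewrite /alpha ord_cons0.
have [e|e] : (-1) ^+ size gs = 1 :> int \/ (-1) ^+ size gs = -1 :> int.
- by rewrite -signr_odd; case: (odd _); [right|left].
- have [bs [Hb sb Tb]] := Pi0_T LT; exists bs; split=> //.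
  by apply/word_eqP => //; [move=> b /Hb/Pi0_Rtimes | rewrite sb e Tb].
- have [bs [Hb sb Tb]] := Pi0_T (LambdaMz (-1) LT); exists (bs ++ [:: eps]).
  have H b : b \in bs ++ [:: eps] -> Pi0 b.
    by rewrite mem_cat inE => /orP[/Hb|/eqP ->].
  split=> //; apply/word_eqP => //; first by move=> b /H/Pi0_Rtimes.
  rewrite size_cat exprD sb e; split=> //.
  rewrite word_T_cat word_T_cons pe mul0rz Tb word_T_nil !add0r.
  by rewrite -mulrzA.
Qed.

Lemma ellP w : weyl w ->
  (exists2 bs, expressions (@Pi0 nu A) w bs & size bs = ell w) /\
  forall bs, expressions (@Pi0 nu A) w bs -> (ell w <= size bs)%N.
Proof.
move=> /weyl_Pi0[bs0 E0].
pose Lb k := `[< exists2 bs, expressions (@Pi0 nu A) w bs & size bs = k >].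
have ex : exists k, Lb k by exists (size bs0); apply/asboolP; exists bs0.
rewrite /ell; set S := [set k | _ /\ _].
suff [h1 h2] : S (xget 0 S) by split=> // bs E; apply: h2; exists bs.
apply: xgetPex; exists (ex_minn ex).
by case: ex_minnP => k /asboolP Lk mk; split=> // j Lj; apply/mk/asboolP.
Qed.

End Consistency.

(* Main.v *)
Require Import Defs.
From mathcomp Require Import all_boot all_order all_algebra.
From HB Require Import structures.
From mathcomp Require Import zify ring.
Local Open Scope ring_scope.
Import Order.TTheory GRing.Theory Num.Theory.

(** The length of an even element is the l1-norm of T(w) in the basis Pi_0,
because a word of even length feeds its letters into T one unit at a time.

For a root g, multiplying g = sgn(g) eps + p(g) by sgn(g) = +-1 gives
sgn(g) p(g) = sgn(g) g - eps. Substituting this in the alternating sum T(w),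
the multiples of eps cancel when the word has even length, so that T(w) is a
sum of +-g over the letters g. If the letters are in Pi_0, each of them moves
the coordinate vector of T(w) in the basis Pi_0 by one unit, whence
sum |n_i| <= length ([le_word_T]).

Conversely, let T(w) = sum n_i alpha_i and put u_i = sgn(alpha_i) n_i. Since
T(w) is in Lambda, sum u_i = sgn(T(w)) = 0; hence the total of the positive u_i
is that of the negative ones, and letters alpha_i with multiplicity |u_i| can
be arranged so that those with u_i > 0 occupy the positions of sign + and the
others the positions of sign - ([alternating_word]). The result is a word of
length sum |u_i| = sum |n_i| with the same T and the same parity as w, hence an
expression of w ([word_T_realize]).

Finally, if T(w) = sum m_j sigma_j, its coordinates in Pi_0 are n_j = m_j for
j > 0 and n_0 = sum m_j = m^+ + m^-, while sum |m_j| = m^+ - m^-. Thus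
sum |n_i| = |m^+ + m^-| + (m^+ - m^-) = 2 max(m^+, |m^-|) = |ht(T(w))|
([sum_abs_acoord]). *)

(** * Coordinates in the fundamental root basis *)

Section FundamentalBasis.
Variables (nu : nat) (A : A1_datum nu).
Implicit Types (a b g : A) (gs bs cs : seq A).

Fact coord_zmod_morphism : zmod_morphism (@Defs.coord nu A).
Proof. by move=> a b; apply: (addIr (Defs.coord b)); rewrite -coordD !subrK. Qed.

HB.instance Definition _ :=
  GRing.isZmodMorphism.Build A {ffun 'I_nu.+1 -> int} (@Defs.coord nu A)
    coord_zmod_morphism.

Fact sgn_zmod_morphism : zmod_morphism (@sgn nu A).
Proof. by move=> a b; rewrite /sgn raddfB !ffunE. Qed.

HB.instance Definition _ :=
  GRing.isZmodMorphism.Build A int (@sgn nu A) sgn_zmod_morphism.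

(** The coordinates of [a] in the basis [alpha]: [sigma j] is
[alpha_(j + 1) + alpha_0], hence each unit of a sigma-coordinate also counts
once along [alpha_0 = eps]. *)
Definition acoord (i : 'I_nu.+1) a : int :=
  ord_cons (sgn a + \sum_j scoord a j) (scoord a) i.

Fact acoord_zmod_morphism i : zmod_morphism (acoord i).
Proof.
have scoordB j a b : scoord (a - b) j = scoord a j - scoord b j.
  by rewrite /scoord raddfB !ffunE.
move=> a b; rewrite /acoord /ord_cons; case: unlift => [j|]; first exact: scoordB.
rewrite raddfB /= (eq_bigr _ (fun j _ => scoordB j a b)) sumrB; ring.
Qed.

HB.instance Definition _ i :=
  GRing.isZmodMorphism.Build A int (acoord i) (acoord_zmod_morphism i).

Lemma Lambda0 : @Lambda nu A 0.
Proof. by move=> b; rewrite Defs.form0l. Qed.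

Lemma sgn_Lambda a : Lambda a -> sgn a = 0.
Proof. by move=> La; have [] := coord_eps_Lambda 0 La; rewrite mulr0z add0r. Qed.

Lemma Lambda_word_T gs : Lambda (word_T gs).
Proof.
apply: (big_ind (@Lambda nu A)) => [||i _]; first exact: Lambda0.
  exact: LambdaD.
exact/LambdaMz/Lambda_p.
Qed.

Lemma coord_eps i : Defs.coord (eps : A) i = (i == ord0)%:Z.
Proof.
have E : eps = zcomb (ord_cons eps (@sigma nu A)) [ffun j => (j == ord0)%:Z].
  rewrite /zcomb (bigD1 ord0) //= big1 => [|j /negPf j0]; rewrite ffunE.
    by rewrite ord_cons0 eqxx addr0.
  by rewrite j0.
by rewrite E coord_zcomb ffunE.
Qed.

Lemma coord_sigma j i : Defs.coord (sigma j : A) i = (i == lift ord0 j)%:Z.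
Proof.
have E : sigma j =
    zcomb (ord_cons eps (@sigma nu A)) [ffun k => (k == lift ord0 j)%:Z].
  rewrite /zcomb (bigD1 (lift ord0 j)) //= big1 => [|k /negPf kj]; rewrite ffunE.
    by rewrite ord_consS eqxx addr0.
  by rewrite kj.
by rewrite E coord_zcomb ffunE.
Qed.

Lemma acoord_alpha i k : acoord i (alpha A k) = (i == k)%:Z.
Proof.
have se : acoord i eps = (i == ord0)%:Z.
  rewrite /acoord /scoord /sgn; case: (unliftP ord0 i) => [j|] ->.
    by rewrite ord_consS coord_eps.
  by rewrite ord_cons0 coord_eps big1 ?addr0 // => j _; rewrite coord_eps.
rewrite /alpha; case: (unliftP ord0 k) => [j|] ->; last by rewrite ord_cons0.
rewrite ord_consS raddfB /= se /acoord /scoord /sgn.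
case: (unliftP ord0 i) => [l|] ->.
  by rewrite ord_consS coord_sigma subr0.
rewrite ord_cons0 coord_sigma (bigD1 j) //= big1 => [|l /negPf lj].
  by rewrite coord_sigma eqxx.
by rewrite coord_sigma (inj_eq lift_inj) lj.
Qed.

Lemma acoord_sum (n : 'I_nu.+1 -> int) i :
  acoord i (\sum_k alpha A k *~ n k) = n i.
Proof.
rewrite raddf_sum (bigD1 i) //= big1 => [|k /negPf ki].
  by rewrite raddfMz /= acoord_alpha eqxx addr0 intz.
by rewrite raddfMz /= acoord_alpha eq_sym ki mul0rz.
Qed.

Lemma acoordK a : \sum_i alpha A i *~ acoord i a = a.
Proof.
rewrite {2}[a]sgn_pE big_ord_recl /p /alpha /acoord !ord_cons0.
have E i : @ord_cons A nu eps (fun j => sigma j - eps) (lift ord0 i) *~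
    ord_cons (sgn a + \sum_j scoord a j) (scoord a) (lift ord0 i) =
    sigma i *~ scoord a i - eps *~ scoord a i.
  by rewrite !ord_consS mulrzBl.
rewrite (eq_bigr _ (fun i _ => E i)) sumrB mulrzDr -addrA; congr (_ + _).
by rewrite mulrz_sumr addrC subrK.
Qed.

(** * Words in the fundamental reflections *)

(** For a root [g], [p g *~ sgn g] is [g *~ sgn g - eps], so that [T] is a signed
sum of the letters, up to the multiple of [eps] given by an alternating sum of
signs, which vanishes for an even number of letters; the triangle inequality
concludes. *)
Lemma le_word_T gs : {in gs, forall g, Pi0 g} -> ~~ odd (size gs) ->
  (\sum_i `|acoord i (word_T gs)| <= size gs)%N.
Proof.
move=> Hgs even.
(* For words of any parity, the alternating sum of signs is the parity bit. *)
suff: (\sum_i `|acoord i (word_T gs + eps *~ odd (size gs))| <= size gs)%N.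
  by rewrite (negPf even) mulr0z addr0.
elim: gs Hgs {even} => [|g gs IH] Hgs.
  by rewrite word_T_nil add0r big1 // => i _; rewrite raddf0.
have /IH{}IH : {in gs, forall h, Pi0 h}.
  by move=> h hgs; apply: Hgs; rewrite in_cons hgs orbT.
have Pg : Pi0 g by apply: Hgs; rewrite mem_head.
have Rg := Pi0_Rtimes Pg.
pose e : int := (-1) ^+ size gs * sgn g.
have -> : word_T (g :: gs) + eps *~ odd (size (g :: gs)) =
    g *~ e + (word_T gs + eps *~ odd (size gs)).
  have -> : g *~ e = eps *~ (sgn g * e) + p g *~ e.
    by rewrite {1}(sgn_pE g) mulrzDl -mulrzA.
  rewrite word_T_cons -/e.
  have -> : sgn g * e = (-1) ^+ size gs by rewrite /e mulrCA sgn_sqr ?mulr1.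
  rewrite -!addrA [RHS]addrCA; congr (_ + _).
  rewrite [RHS]addrCA; congr (_ + _); rewrite -mulrzDr; congr (_ *~ _).
  by rewrite /= -signr_odd; case: odd.
apply: (@leq_trans (\sum_i (`|acoord i (g *~ e)| +
    `|acoord i (word_T gs + eps *~ odd (size gs))|))%N).
  by apply: leq_sum => i _; rewrite raddfD /=; lia.
rewrite big_split /= -(add1n (size gs)) leq_add //.
have e1 : `|e|%N = 1%N.
  by rewrite /e -signr_odd; case: (Rtimes_sgn Rg) => ->; case: odd.
have [k _ <-] := Pg; rewrite (bigD1 k) //= big1 => [|i /negPf ik].
  by rewrite raddfMz /= acoord_alpha eqxx addn0 intz e1.
by rewrite raddfMz /= acoord_alpha ik mul0rz.
Qed.

(** Interleaving [bs] and [cs], the letters of [cs] are at an even distance from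
the end of the word, those of [bs] at an odd distance. *)
Lemma alternating_word bs cs : size bs = size cs ->
  exists gs, [/\ {subset gs <= bs ++ cs}, size gs = (size bs).*2
    & word_T gs = \sum_(g <- cs) p g *~ sgn g - \sum_(g <- bs) p g *~ sgn g].
Proof.
move: bs cs; apply: seq_ind2 => [|b c bs cs _ [gs [sub sz Tgs]]].
  by exists [::]; rewrite word_T_nil !big_nil subrr.
exists (b :: c :: gs); split=> /=.
- move=> g; rewrite !inE !mem_cat inE => /or3P[->|->|/sub]; rewrite ?orbT //.
  by rewrite mem_cat => /orP[] ->; rewrite /= !orbT.
- by rewrite sz.
- rewrite !word_T_cons Tgs /= exprS -signr_odd sz odd_double !big_cons.
  rewrite !(mulr1, mul1r, mulN1r) mulrNz opprD [RHS]addrCA.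
  by congr (_ + _); rewrite addrA.
Qed.

Lemma letters_mult (k : 'I_nu.+1 -> nat) : exists bs,
  [/\ {in bs, forall b, Pi0 b}, size bs = (\sum_i k i)%N
    & forall F : A -> A, \sum_(b <- bs) F b = \sum_i F (alpha A i) *+ k i].
Proof.
exists (flatten [seq nseq (k i) (alpha A i) | i <- index_enum 'I_nu.+1]); split.
- move=> b /flatten_mapP[i _]; rewrite mem_nseq => /andP[_ /eqP ->].
  by exists i.
- rewrite size_flatten /shape -map_comp sumnE big_map.
  by apply: eq_bigr => i _; rewrite /= size_nseq.
- move=> F; rewrite big_flatten big_map; apply: eq_bigr => i _.
  by rewrite big_nseq -Monoid.iteropE.
Qed.

(** The hypothesis says that the letters that must have sign + in [T] are as many
as those that must have sign -, which is what makes an alternating arrangement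
possible. *)
Lemma word_T_realize (n : 'I_nu.+1 -> int) :
    sgn (\sum_i alpha A i *~ n i) = 0 ->
  exists gs, [/\ {in gs, forall g, Pi0 g}, ~~ odd (size gs),
    size gs = (\sum_i `|n i|)%N & word_T gs = \sum_i alpha A i *~ n i].
Proof.
move=> sgn0.
have Ra i : Rtimes (alpha A i) by apply: Pi0_Rtimes; exists i.
(* [sgn g * p g], rather than [g], is what a letter contributes to [T], up to
   sign; [u i] is the coefficient with which [alpha i] has to contribute. *)
pose u i := n i * sgn (alpha A i).
have sum_u : \sum_i u i = 0.
  rewrite -[RHS]sgn0 raddf_sum; apply: eq_bigr => i _.
  by rewrite raddfMz /= /u -mulrzr intz mulrC.
have [cs [Hc sc Fc]] := letters_mult (fun i => `|Num.max (u i) 0|%N).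
have [bs [Hb sb Fb]] := letters_mult (fun i => `|Num.min (u i) 0|%N).
have eq_size : size bs = size cs.
  apply/eqP; rewrite -eqz_nat eq_sym -subr_eq0 sb sc.
  rewrite !(big_morph Posz PoszD (erefl _)) -sumrB -[X in _ == X]sum_u.
  by apply/eqP/eq_bigr => i _; lia.
have [gs [sub sz Tgs]] := alternating_word _ _ eq_size.
exists gs; split.
- by move=> g /sub; rewrite mem_cat => /orP[/Hb|/Hc].
- by rewrite sz odd_double.
- rewrite sz -addnn {2}eq_size sb sc -big_split; apply: eq_bigr => i _ /=.
  have : `|u i|%N = `|n i|%N.
    by rewrite /u; case: (Rtimes_sgn (Ra i)) => ->; lia.
  lia.
- rewrite Tgs Fc Fb -sumrB.
  have E i : p (alpha A i) *~ sgn (alpha A i) *+ `|Num.max (u i) 0| -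
      p (alpha A i) *~ sgn (alpha A i) *+ `|Num.min (u i) 0| =
      alpha A i *~ n i - eps *~ u i.
    have uE : (`|Num.max (u i) 0|%N)%:Z - (`|Num.min (u i) 0|%N)%:Z = u i by lia.
    rewrite !pmulrn -mulrzBr uE -mulrzA [X in _ = X *~ _ - _]sgn_pE mulrzDl.
    by rewrite -mulrzA /u [n i * _]mulrC [RHS]addrC addKr mulrA sgn_sqr ?mul1r.
  by rewrite (eq_bigr _ (fun i _ => E i)) sumrB -mulrz_sumr sum_u mulr0z subr0.
Qed.

(** * The height as a norm *)

(** Both sides are [2 max(m^+, |m^-|)]: the coordinate along [alpha_0] is
[m^+ + m^-], and the others have absolute values of sum [m^+ - m^-]. *)
Lemma sum_abs_acoord a : sgn a = 0 ->
  (\sum_i `|acoord i a|)%N = `|ht a|%N.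
Proof.
move=> s0; rewrite big_ord_recl /acoord ord_cons0 s0 add0r.
under [X in (_ + X)%N]eq_bigr do rewrite ord_consS.
have sum_pm : \sum_j scoord a j = mplus a + mminus a.
  rewrite /mplus /mminus [in RHS]big_mkcond [X in _ = _ + X]big_mkcond -big_split.
  by apply: eq_bigr => j _ /=; case: (ltgtP (scoord a j) 0); lia.
have abs_pm : (\sum_j `|scoord a j|)%N%:Z = mplus a - mminus a.
  rewrite /mplus /mminus [in RHS]big_mkcond [X in _ = _ - X]big_mkcond -sumrB.
  rewrite (big_morph Posz PoszD (erefl _)).
  by apply: eq_bigr => j _ /=; case: (ltgtP (scoord a j) 0); lia.
have p0 : 0 <= mplus a by apply: sumr_ge0 => j /ltW.
have m0 : mminus a <= 0 by apply: sumr_le0 => j /ltW.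
rewrite sum_pm /ht s0 /= add0r /ht0.
move: (mplus a) (mminus a) (\sum_j _)%N p0 m0 abs_pm => x y N x0 y0 xyN.
by rewrite ler0_norm //; case: ifP; lia.
Qed.

End FundamentalBasis.

Theorem corollary2p13 (nu : nat) (A : A1_datum nu) (w : A -> A)
    (hw : weyl0 w) :
  ell w = `|ht (T w)|%N /\
  forall n : 'I_nu.+1 -> int,
    T w = \sum_(i < nu.+1) alpha A i *~ n i ->
    ell w = (\sum_(i < nu.+1) `|n i|)%N.
Proof.
have [ww epsw] := hw; have [[bs [Pbs wE] szbs] ell_min] := ellP ww.
have Rbs : {in bs, forall b, Rtimes b} by move=> b /Pbs/Pi0_Rtimes.
have TE : T w = word_T bs by rewrite wE T_word.
have even : (-1) ^+ size bs = 1 :> int by rewrite -epsW_word // -wE.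
have sgnT : sgn (T w) = 0 by rewrite TE; apply/sgn_Lambda/Lambda_word_T.
have main (n : 'I_nu.+1 -> int) : T w = \sum_(i < nu.+1) alpha A i *~ n i ->
    ell w = (\sum_(i < nu.+1) `|n i|)%N.
  move=> Tn; apply/eqP; rewrite eqn_leq; apply/andP; split.
    have [|gs [Pgs ogs <- Tgs]] := word_T_realize _ A n; first by rewrite -Tn.
    apply: ell_min; split=> //; rewrite wE.
    apply/(word_eqP Rbs) => [g /Pgs/Pi0_Rtimes //|].
    by rewrite even -signr_odd (negPf ogs) -TE Tgs.
  rewrite -szbs (leq_trans _ (le_word_T _ _ _ Pbs _)) //.
    by rewrite -TE Tn; apply: leq_sum => i _; rewrite acoord_sum.
  by move: even; rewrite -signr_odd; case: odd.
split=> //; rewrite -sum_abs_acoord //.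
by apply: main; rewrite acoordK.
Qed.
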